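(* Let $n$ objects be distributed over $p$ processing elements (PEs), each PE holding its local objects as a sorted sequence $s$, and let $\underline{k}\le\overline{k}$ be positive integers. If $\overline{k}-\underline{k}=\Omega(\overline{k})$, then Algorithm amsSelect (defined in the context) finds the $k$ globally smallest elements for some $k$ with $\underline{k}\le k\le\overline{k}$, in expected time $O(\log\overline{k}+\alpha\log p)$.
   Context: Machine model: $p$ PEs are connected by a network. Each PE can send and receive at most one message at a time (full-duplex, single-ported communication), and sending a message of $m$ machine words takes time $\alpha+m\beta$; $\alpha$ and $\beta$ are treated as variables in asymptotic bounds. Objects are single machine words and totally ordered without ties. Variables are local to each PE; $x@i$ denotes the value of variable $x$ on PE $i$. Geometrically distributed random numbers can be generated in constant time. Expectation is over the random choices of the algorithm. Algorithm amsSelect$(s,\underline{k},\overline{k},n)$, run on every PE, where $s$ (1-indexed, increasingly sorted) is the local sequence and $n$ is the total number of objects over all PEs: 1. If $\underline{k}<n-\overline{k}$: each PE independently draws a geometrically distributed number $x$ (values $1,2,\dots$) with success parameter $1-\left(\frac{\underline{k}-1}{\overline{k}}\right)^{1/(\overline{k}-\underline{k}+1)}$, sets $v:=\infty$ if $x>|s|$ and $v:=s[x]$ otherwise; then all PEs set $v:=\min_{1\le i\le p}v@i$. Otherwise: each PE independently draws a geometrically distributed number $x$ with success parameter $1-\left(\frac{n-\overline{k}}{n-\underline{k}+1}\right)^{1/(\overline{k}-\underline{k}+1)}$, sets $v:=-\infty$ if $x>|s|$ and $v:=s[|s|-x+1]$ otherwise; then all PEs set $v:=\max_{1\le i\le p}v@i$.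 2. Each PE finds $j$ such that all of $s[1..j]$ is $\le v$ and all of $s[j+1..|s|]$ is $>v$. Let $k:=\sum_{1\le i\le p}j@i$. 3. If $k<\underline{k}$, return $s[1..j]\cup$ amsSelect$(s[j+1..|s|],\underline{k}-k,\overline{k}-k,n-k)$. If $k>\overline{k}$, return amsSelect$(s[1..j],\underline{k},\overline{k},k)$. Otherwise return $s[1..j]$. The output is distributed: each PE returns its local part of the selected elements.
   Formalization: Assumes α ≥ a0 and β ≤ bα for fixed constants a0, b > 0, on which the hidden constant may depend (the stated bound omits β and fails for p ≥ 2 when β is unbounded relative to α), and that klo ≤ n. *)

(* Defs.v *)
From HB Require Import structures.
From mathcomp Require Import all_boot all_order all_algebra.
From mathcomp Require Import all_classical all_reals all_analysis.
Set Implicit Arguments.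
Unset Strict Implicit.
Unset Printing Implicit Defensive.
Import Order.TTheory GRing.Theory Num.Theory.

Local Open Scope ring_scope.

(** ** Objects extended with -oo and +oo *)

Section ExtendedObjects.
Context {d : Order.disp_t} {T : orderType d}.

Variant xobj := NegInf | Obj of T | PosInf.

Definition xle (u v : xobj) : bool :=
  match u, v with
  | NegInf, _ | _, PosInf => true
  | Obj x, Obj y => (x <= y)%O
  | _, _ => false
  end.

Definition xmin (u v : xobj) := if xle u v then u else v.
Definition xmax (u v : xobj) := if xle u v then v else u.

Let xle_refl u : xle u u.
Proof. by case: u => //= x; exact: lexx. Qed.

Let xle_trans v u w : xle u v -> xle v w -> xle u w.
Proof.
by case: u => [|u|]; case: v => [|v|]; case: w => [|w|] //=; exact: le_trans.
Qed.

Let xle_anti u v : xle u v -> xle v u -> u = v.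
Proof.
case: u => [|u|]; case: v => [|v|] //= uv vu.
by congr Obj; apply/le_anti; rewrite uv.
Qed.

Let xle_total u v : xle u v || xle v u.
Proof. by case: u => [|u|]; case: v => [|v|] //=; exact: le_total. Qed.

Let xleNge u v : xle u v = false -> xle v u.
Proof. by move=> uv; have := xle_total u v; rewrite uv. Qed.

Lemma xminA : associative xmin.
Proof.
move=> u v w; rewrite /xmin.
case vw: (xle v w); case uv: (xle u v); rewrite ?vw ?uv //.
- by rewrite (xle_trans uv vw).
- case uw: (xle u w) => //.
  by rewrite (xle_trans uw (xleNge vw)) in uv.
Qed.

Lemma xminC : commutative xmin.
Proof.
move=> u v; rewrite /xmin; case uv: (xle u v); case vu: (xle v u) => //.
  exact: xle_anti.
by move: (xleNge uv); rewrite vu.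
Qed.

Lemma xmin1 : left_id PosInf xmin.
Proof. by case. Qed.

Lemma xmaxA : associative xmax.
Proof.
move=> u v w; rewrite /xmax.
case vw: (xle v w); case uv: (xle u v); rewrite ?vw ?uv //.
- by rewrite (xle_trans uv vw).
- case uw: (xle u w) => //.
  by rewrite (xle_trans (xle_trans uw (xleNge vw)) (xle_refl v)) in uv.
Qed.

Lemma xmaxC : commutative xmax.
Proof.
move=> u v; rewrite /xmax; case uv: (xle u v); case vu: (xle v u) => //.
  exact: xle_anti.
by move: (xleNge uv); rewrite vu.
Qed.

Lemma xmax1 : left_id NegInf xmax.
Proof. by case. Qed.

HB.instance Definition _ :=
  Monoid.isComLaw.Build xobj PosInf xmin xminA xminC xmin1.
HB.instance Definition _ :=
  Monoid.isComLaw.Build xobj NegInf xmax xmaxA xmaxC xmax1.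

End ExtendedObjects.
Arguments xobj {d} T.

(** ** The machine: [p] PEs with local clocks, single-ported message passing *)

(* One communication step: [sender i] is the PE, if any, whose message PE i
   receives.  A PE receives at most one message because [sender] is a function;
   [single_ported] says that it also sends at most one.  It may do both at the
   same time (full duplex). *)
Record pattern (p : nat) := Pattern {
  sender :> 'I_p -> option 'I_p;
  single_ported : forall i i' j,
    sender i = Some j -> sender i' = Some j -> i = i'
}.

Section Machine.
Context {R : realType} (alpha beta : R) {p : nat}.

Definition clocks := 'I_p -> R.

Definition elapse (c : 'I_p -> nat) (clk : clocks) : clocks :=
  fun i => clk i + (c i)%:R.

Definition message_time (m : nat) : R := alpha + m%:R * beta.

(* A transfer starts when both of its endpoints are ready and lasts
   [message_time 1]: all messages used here are single words.  The receiver
   then spends one unit of local time on combining the word received with its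
   own value. *)
Definition deliver (V : Type) (pt : pattern p) (f : V -> V -> V)
    (c : ('I_p -> V) * clocks) : ('I_p -> V) * clocks :=
  (fun i => if pt i is Some j then f (c.1 i) (c.1 j) else c.1 i,
   fun i => \big[Num.max/c.2 i]_(j | (pt i == Some j) || (pt j == Some i))
              (Num.max (c.2 i) (c.2 j) + message_time 1)
            + (pt i != None)%:R).

Definition up_sender (e : nat) (i : 'I_p) : option 'I_p :=
  if (2 * e %| i)%N then insub (i + e)%N else None.

Definition down_sender (e : nat) (i : 'I_p) : option 'I_p :=
  if (i %% (2 * e) == e)%N then insub (i - e)%N else None.

Lemma up_single_ported e i i' j :
  up_sender e i = Some j -> up_sender e i' = Some j -> i = i'.
Proof.
rewrite /up_sender; case: ifP => // _; case: ifP => // _.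
case: insubP => // u _ uE [<-]; case: insubP => // u' _ u'E [uu'].
by apply/val_inj/(@addIn e); rewrite /= -uE -u'E uu'.
Qed.

Lemma down_single_ported e i i' j :
  down_sender e i = Some j -> down_sender e i' = Some j -> i = i'.
Proof.
rewrite /down_sender; case: eqP => // ie; case: eqP => // i'e.
have ei : (e <= i)%N by rewrite -{1}ie leq_mod.
have ei' : (e <= i')%N by rewrite -{1}i'e leq_mod.
case: insubP => // u _ uE [<-]; case: insubP => // u' _ u'E [uu'].
by apply/val_inj; rewrite /= -(subnK ei) -(subnK ei') -uE -u'E uu'.
Qed.

Definition up_pattern e := Pattern (@up_single_ported e).
Definition down_pattern e := Pattern (@down_single_ported e).

Definition distances : seq nat := [seq 2 ^ t | t <- iota 0 (up_log 2 p)]%N.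

(* Binomial-tree reduction to PE 0 followed by a binomial-tree broadcast. *)
Definition all_reduce (V : Type) (op : V -> V -> V)
    (c : ('I_p -> V) * clocks) : ('I_p -> V) * clocks :=
  foldl (fun c e => deliver (down_pattern e) (fun _ y => y) c)
    (foldl (fun c e => deliver (up_pattern e) op c) c distances)
    (rev distances).

(* The statement "x := op over all PEs j of x@j"; the common value that it
   leaves in x on every PE is the one computed by the messages, by
   [all_reduceE] below. *)
Definition collective (V : Type) (op : V -> V -> V) (idx : V)
    (val : 'I_p -> V) (clk : clocks) : V * clocks :=
  (\big[op/idx]_j val j, (all_reduce op (val, clk)).2).

Lemma all_reduceE (V : Type) (idx : V) (op : Monoid.law idx)
    (val : 'I_p -> V) (clk : clocks) (i : 'I_p) :
  (all_reduce op (val, clk)).1 i = (collective op idx val clk).1.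
Proof.
pose g k := if insub k is Some j then val j else idx.
have g0 k : (p <= k)%N -> g k = idx.
  by move=> pk; rewrite /g insubN // -leqNgt.
have up m (l : 'I_p) : (2 ^ m %| l)%N ->
    (foldl (fun c e => deliver (up_pattern e) op c) (val, clk)
       [seq 2 ^ t | t <- iota 0 m]%N).1 l
    = \big[op/idx]_(l <= k < l + 2 ^ m) g k.
  elim: m l => [|m IH] l ml.
    by rewrite /= expn0 addn1 big_nat1 /g valK.
  rewrite -(addn1 m) iotaD map_cat foldl_cat add0n /= addn1.
  have ml' : (2 ^ m %| l)%N.
    by apply: dvdn_trans ml; rewrite dvdn_exp2l.
  rewrite /up_sender -expnS ml.
  rewrite (@big_cat_nat _ _ _ (l + 2 ^ m)%N) ?leq_addr //=; last first.
    by rewrite leq_add2l leq_exp2l.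
  rewrite (IH l ml').
  case: insubP => [u _ uE|]; last first.
    rewrite -leqNgt => pl.
    rewrite [X in op _ X]big_nat_cond [X in op _ X]big1 ?Monoid.mulm1 //.
    by move=> k /andP[/andP[lk _] _]; rewrite g0 // (leq_trans pl).
  rewrite (IH u) ?uE ?dvdn_add //=.
  by rewrite expnS mul2n -addnn addnA.
have down m c S : (forall l : 'I_p, (2 ^ m %| l)%N -> c.1 l = S) ->
    forall l, (foldl (fun c e => deliver (down_pattern e) (fun _ y => y) c) c
       (rev [seq 2 ^ t | t <- iota 0 m]%N)).1 l = S.
  elim: m c => [|m IH] c cS l; first by apply: cS; rewrite expn0 dvd1n.
  rewrite -(addn1 m) iotaD map_cat rev_cat foldl_cat add0n /=.
  apply: IH => {}l ml /=; rewrite /down_sender -expnS.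
  have lm : (l < p)%N by [].
  case: eqP => [le|/eqP le].
    rewrite insubT /=; first by rewrite (leq_ltn_trans (leq_subr _ _)).
    move=> h; apply: cS => /=.
    by rewrite {1}(divn_eq l (2 ^ m.+1)) le addnK dvdn_mull.
  apply: cS; have /dvdnP[q lq] := ml; move: le.
  rewrite lq expnS -muln_modl -{2}(mul1n (2 ^ m)%N).
  rewrite eqn_pmul2r ?expn_gt0 // modn2 dvdn_pmul2r ?expn_gt0 // dvdn2.
  by case: odd.
rewrite /all_reduce /distances; apply: down => l rl.
rewrite up //.
have pr := up_logP p (isT : 1 < 2)%N.
have -> : l = 0%N :> nat.
  by apply/eqP; move: rl; apply: contraLR; rewrite -lt0n => l0; apply/negP => /(dvdn_leq l0);
     rewrite leqNgt (leq_trans _ pr).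
rewrite add0n (@big_cat_nat _ _ _ p) //= [X in op _ X]big_nat_cond.
rewrite [X in op _ X]big1 ?Monoid.mulm1; last first.
  by move=> k /andP[/andP[pk _] _]; exact: g0.
by rewrite big_mkord; apply: eq_bigr => j _; rewrite /g valK.
Qed.

End Machine.

(** ** Locating the pivot in a sorted local sequence *)

(* Exponential search from the front.  Sequence positions are 1-based; each
   function also returns the number of objects probed, its running time. *)
Section Locate.
Context {d : Order.disp_t} {T : orderType d} (s : seq T) (v : xobj T).

Definition probe (m : nat) : bool :=
  if onth s m.-1 is Some y then xle (Obj y) v else false.

Fixpoint gallop (fuel hi : nat) : nat * nat :=
  if fuel is fuel'.+1 then
    if probe hi then
      let: (r, c) := gallop fuel' hi.*2 in (r, c.+1)
    else (hi, 1%N)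
  else (hi, 0%N).

Fixpoint bisect (fuel lo hi : nat) : nat * nat :=
  if fuel is fuel'.+1 then
    if (lo < hi)%N then
      let m := uphalf (lo + hi) in
      let: (r, c) :=
        if probe m then bisect fuel' m hi else bisect fuel' lo m.-1 in
      (r, c.+1)
    else (lo, 0%N)
  else (lo, 0%N).

Definition locate : nat * nat :=
  let: (hi, c) := gallop (size s).+1 1 in
  let: (j, c') := bisect (size s) hi./2 (minn hi.-1 (size s)) in
  (j, (c + c')%N).

End Locate.

(** ** Algorithm amsSelect *)

Section AmsSelect.
Context {R : realType} (alpha beta : R) {d : Order.disp_t} {T : orderType d}.
Context {p : nat}.
Implicit Types (s : 'I_p -> seq T) (klo khi n : nat).

Definition geometric_pmf (theta : R) (x : nat) : R :=
  if x is y.+1 then (1 - theta) ^+ y * theta else 0.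

Definition from_front klo khi n : bool := (klo < n - khi)%N.

(* [n - khi] is truncated subtraction: for [n < khi] the second formula gives
   success parameter 1, so that the pivot is the largest object. *)
Definition success klo khi n : R :=
  let e := ((khi - klo).+1)%:R^-1 in
  if from_front klo khi n then 1 - ((klo.-1)%:R / khi%:R) `^ e
  else 1 - ((n - khi)%:R / ((n - klo).+1)%:R) `^ e.

(* [onth] is 0-based: these are s[x] and s[|s| - x + 1] with 1-based positions,
   and the default when [x] exceeds the length. *)
Definition candidate_front (l : seq T) (x : nat) : xobj T :=
  if onth l x.-1 is Some y then Obj y else PosInf.

Definition candidate_back (l : seq T) (x : nat) : xobj T :=
  if onth (rev l) x.-1 is Some y then Obj y else NegInf.

Definition draws := {ffun 'I_p -> nat}.

Record run := Run {
  output : 'I_p -> seq T;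
  final_clocks : @clocks R p;
  likelihood : R
}.

Definition prepend (o : 'I_p -> seq T) (r : run) : run :=
  Run (fun i => o i ++ output r i) (final_clocks r) (likelihood r).

(* The execution in which the successive levels of recursion draw the elements
   of the trace [h]; it is [None] unless the algorithm returns after drawing
   exactly [h].  [w] accumulates the probability of the draws.  The two unit
   steps per level stand for the constant-time local work: computing the
   success parameter, drawing and reading the candidate; and comparing [k] with
   the bounds and splitting the local sequence, which is a change of indices.
   The arguments [klo], [khi], [n] and the sum [k] are equal on all PEs. *)
Fixpoint amsSelect (h : seq draws) s klo khi n (clk : clocks) (w : R)
    : option run :=
  if h is x :: h' then
    let w := w * \prod_i geometric_pmf (success klo khi n) (x i) in
    let clk := elapse (fun=> 1%N) clk in
    let: (v, clk) :=
      if from_front klo khi n then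
        collective alpha beta xmin PosInf
          (fun i => candidate_front (s i) (x i)) clk
      else
        collective alpha beta xmax NegInf
          (fun i => candidate_back (s i) (x i)) clk in
    let j i := (locate (s i) v).1 in
    let clk := elapse (fun i => (locate (s i) v).2) clk in
    let: (k, clk) := collective alpha beta addn 0%N j clk in
    let clk := elapse (fun=> 1%N) clk in
    let below i := take (j i) (s i) in
    let above i := drop (j i) (s i) in
    if (k < klo)%N then
      omap (prepend below)
        (amsSelect h' above (klo - k) (khi - k) (n - k) clk w)
    else if (khi < k)%N then amsSelect h' below klo khi k clk w
    else if h' is [::] then Some (Run below clk w) else None
  else None.

Definition objects s : seq T := flatten [seq s i | i <- enum 'I_p].

Definition ams_run s klo khi (h : seq draws) : option run :=
  amsSelect h s klo khi (size (objects s)) (fun=> 0) 1.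

(* PE i returns exactly its own objects among the k globally smallest ones. *)
Definition selects_smallest s (k : nat) (o : 'I_p -> seq T) : Prop :=
  (k <= size (objects s))%N /\
  forall i, o i = [seq y <- s i | y \in take k (sort <=%O (objects s))].

Definition running_time (r : run) : R := \big[Num.max/0]_i final_clocks r i.

(* Expectation of a nonnegative function of the run, over the runs that
   terminate; [mean (fun=> 1)] is the probability of termination. *)
Definition mean s klo khi (f : run -> R) : \bar R :=
  (\esum_(h in [set: seq draws])
     (if ams_run s klo khi h is Some r then (likelihood r * f r)%:E else 0%E))%R.

End AmsSelect.

(* Main.v *)
Require Import Defs.
From mathcomp Require Import all_boot all_order all_algebra.
From mathcomp Require Import all_classical all_reals all_analysis.
From mathcomp Require Import zify ring lra.
Set Implicit Arguments.
Unset Strict Implicit.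
Unset Printing Implicit Defensive.
Import Order.TTheory GRing.Theory Num.Theory.
Import numFieldNormedType.Exports.
Local Open Scope ring_scope.

(* Drawing geometric positions independently on all PEs amounts to sampling
   every object independently with probability [1 - q], so that the rank [k] of
   the pivot (from below or from above) satisfies [P(k > m) = q ^ m].  The search
   stops when this rank lies in a window [a < k <= K], which has probability
   [q ^ a - q ^ K]; the algorithm takes [q ^ (K - a) = a / K], which makes this
   at least [c / e].  As [E k <= 2 khi / c], the logarithmic cost of locating the
   pivot is [O(log khi)] in expectation at each level, whatever the history, and
   the number of levels is dominated by a geometric variable with parameter
   [c / e].  Correctness holds for every outcome of the draws, since the output
   on each PE is cut out by the same downward closed predicate. *)

(** * Downward closed predicates and sorted sequences *)

Section DownClosed.
Context {d : Order.disp_t} {T : orderType d}.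
Implicit Types (l : seq T) (P : pred T) (v : xobj T).

Definition down_closed P := forall x y, (x <= y)%O -> P y -> P x.

Definition upto v : pred T := fun y => xle (Obj y) v.

Lemma upto_down v : down_closed (upto v).
Proof. by case: v => [|v|] x y //= xy; apply: le_trans. Qed.

Lemma down_closed_filter0 P x l : down_closed P -> ~~ P x ->
  all (>= x)%O l -> seq.filter P l = [::].
Proof.
move=> dP nPx /allP xl; apply/eqP; rewrite -[_ == _]negbK -has_filter.
by apply/hasPn => y /xl xy; apply: contra nPx; exact: dP.
Qed.

Lemma down_closed_filter P l : down_closed P -> sorted <=%O l ->
  seq.filter P l = take (count P l) l.
Proof.
move=> dP; elim: l => //= x l IH; rewrite path_sortedE; last exact: le_trans.
move=> /andP[xl /IH {}IH]; case: ifPn => Px; first by rewrite add1n /= IH.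
by rewrite -size_filter (down_closed_filter0 dP Px xl).
Qed.

Lemma down_closed_filterC P l : down_closed P -> sorted <=%O l ->
  seq.filter (predC P) l = drop (count P l) l.
Proof.
move=> dP; elim: l => //= x l IH; rewrite path_sortedE; last exact: le_trans.
move=> /andP[xl /IH {}IH]; have [Px|Px] := boolP (P x); first by rewrite IH.
have c0 : count P l = 0%N.
  by rewrite -size_filter (down_closed_filter0 dP Px xl).
by rewrite IH c0 drop0.
Qed.

Lemma onth_down_closed P l i : down_closed P -> sorted <=%O l ->
  (if onth l i is Some y then P y else false) = (i < count P l)%N.
Proof.
move=> dP; elim: l i => [|x l IH] i; first by rewrite onthE /= nth_nil.
rewrite /= path_sortedE; last exact: le_trans.
move=> /andP[xl sl]; have [Px|Px] := boolP (P x).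
  by case: i => [|i] //=; rewrite IH.
rewrite -size_filter (down_closed_filter0 dP Px xl) addn0 ltn0.
case: i => [|i] /=; first exact/negbTE.
by rewrite IH // -size_filter (down_closed_filter0 dP Px xl).
Qed.

Section Locate.
Variables (l : seq T) (v : xobj T).
Hypothesis sl : sorted <=%O l.
Let j := count (upto v) l.

Lemma probeE m : (0 < m)%N -> probe l v m = (m <= j)%N.
Proof.
by case: m => // m _; exact: (onth_down_closed _ (@upto_down v) sl).
Qed.

(** Every successful probe has [hi <= j], so doubling never passes [2 * j]; the last conjunct bounds
    the number of probes logarithmically without mentioning logarithms. The bound on [hi * 2 ^ fuel]
    ensures that the fuel outlasts the search. *)
Lemma gallopP fuel hi : (0 < hi <= 2 * j + 1)%N -> (j < hi * 2 ^ fuel)%N ->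
  let: (r, c) := gallop l v fuel hi in
  [/\ (r <= 2 * j + 1)%N, (j < r)%N & (hi * 2 ^ c <= 4 * j + 2)%N].
Proof.
elim: fuel hi => [|fuel IH] hi /=.
  by rewrite expn0 !muln1 => hij jhi; split; lia.
move=> hij jhi; rewrite probeE; last by lia.
case: leqP => hj; last by rewrite expn1; split; lia.
have := IH hi.*2; case: gallop => r c; rewrite -mul2n.
rewrite expnS in jhi.
case; [lia|by rewrite -mulnA mulnCA|].
by move=> ? ? ?; split => //; rewrite expnS; lia.
Qed.

(** Each probe halves the interval. The boolean summand covers an interval that is already a point,
    where no probe is made and [2 ^ 0 = 1]. *)
Lemma bisectP fuel lo hi : (lo <= j <= hi)%N -> (hi - lo <= fuel)%N ->
  let: (r, c) := bisect l v fuel lo hi in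
  r = j /\ (2 ^ c <= 2 * (hi - lo) + (hi == lo))%N.
Proof.
elim: fuel lo hi => [|fuel IH] lo hi /= jlh.
  by rewrite leqn0 expn0 => /eqP ?; split; lia.
move=> hl; case: ltnP => lh; last by rewrite expn0; split; lia.
rewrite probeE; last by lia.
case: leqP => mj.
  have := IH (uphalf (lo + hi)) hi; case: bisect => r c.
  by case; [lia|lia|move=> -> ?; split => //; rewrite expnS; lia].
have := IH lo (uphalf (lo + hi)).-1; case: bisect => r c.
by case; [lia|lia|move=> -> ?; split => //; rewrite expnS; lia].
Qed.

(** Galloping and bisection each take about [log j] probes, whence the square. The cost depends on
    the local rank [j] and not on [size l], which is what makes the final bound logarithmic in
    [khi]. *)
Lemma locateP : (locate l v).1 = j /\ (2 ^ (locate l v).2 <= 16 * j.+1 ^ 2)%N.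
Proof.
have jl : (j <= size l)%N by exact: count_size.
rewrite /locate; have := @gallopP (size l).+1 1; case: gallop => hi c.
case=> [|| h1 h2 h3].
- lia.
- by rewrite mul1n; apply: leq_ltn_trans jl _; apply: ltn_trans (ltn_expl _ _).
have := @bisectP (size l) hi./2 (minn hi.-1 (size l)); case: bisect => r c'.
case=> [||-> h4] /=; [lia|lia|split => //].
rewrite expnD -[16%N]/(4 * 4)%N expnS expn1 mulnACA.
by apply: leq_mul; lia.
Qed.

End Locate.

End DownClosed.

(** * Distributed objects and their smallest elements *)

Section Objects.
Context {d : Order.disp_t} {T : orderType d} {p : nat}.
Implicit Types (s : 'I_p -> seq T) (P : pred T).

Lemma objects_filter P s :
  objects (fun i => seq.filter P (s i)) = seq.filter P (objects s).
Proof. by rewrite /objects filter_flatten -map_comp. Qed.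

Lemma count_objects P s : count P (objects s) = (\sum_i count P (s i))%N.
Proof.
by rewrite /objects count_flatten -map_comp sumnE big_map big_enum.
Qed.

Lemma mem_objects s i y : y \in s i -> y \in objects s.
Proof.
by move=> ys; apply/flattenP; exists (s i) => //; apply: map_f;
  rewrite mem_enum.
Qed.

(** A downward closed predicate cuts a prefix out of the globally sorted list, so belonging to that
    prefix is the same test as [P] on every PE. *)
Lemma selects_smallest_down P s : down_closed P ->
  selects_smallest s (count P (objects s)) (fun i => seq.filter P (s i)).
Proof.
move=> dP; split=> [|i]; first exact: count_size.
apply: eq_in_filter => y /mem_objects ys.
have /permP -> : perm_eq (objects s) (sort <=%O (objects s)).
  by rewrite perm_sym perm_sort.
rewrite -down_closed_filter //.
by rewrite mem_filter mem_sort ys andbT.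
Qed.

(** Supplies a threshold of any prescribed global rank, so that events about the rank of the pivot
    become events about local counts. *)
Lemma down_closed_count s m : uniq (objects s) -> (m <= size (objects s))%N ->
  exists2 D : pred T, down_closed D & count D (objects s) = m.
Proof.
move=> us ms; set l := sort <=%O (objects s).
have pl : perm_eq (objects s) l by rewrite perm_sym perm_sort.
have /permP cl := pl.
have : sorted <%O l.
  rewrite lt_sorted_uniq_le -(perm_uniq pl) us; exact: sort_le_sorted.
have {}ms : (m <= size l)%N by rewrite size_sort.
rewrite lt_sorted_pairwise -[X in pairwise _ X](cat_take_drop m) pairwise_cat.
move=> /andP[/allrelP td _].
(* Being below the whole remaining suffix also makes sense for [m = size l], where the suffix is
   empty and there is no threshold object. *)
exists (fun y => all (fun z => y < z)%O (drop m l)).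
  by move=> x y xy; apply: sub_all => z; apply: le_lt_trans.
rewrite cl -[X in count _ X](cat_take_drop m) count_cat.
rewrite (_ : count _ (take m l) = m); last first.
  rewrite -[RHS](size_takel ms); apply/eqP; rewrite -all_count.
  by apply/allP => y yt; apply/allP => z; exact: td.
rewrite -[RHS]addn0; congr addn; apply/eqP; rewrite -leqn0 leqNgt -has_count.
by apply/hasPn => y yd; apply/negP => /allP/(_ y yd); rewrite ltxx.
Qed.

End Objects.

(** * Duration and outcome of one level of recursion *)

Section Machine.
Context {R : realType} (alpha beta : R) {p : nat}.
Hypothesis time_ge0 : 0 <= message_time alpha beta 1.
Let tau := message_time alpha beta 1 + 1.

Lemma deliver_time (V : Type) (pt : pattern p) (f : V -> V -> V) c M :
  (forall i, c.2 i <= M) ->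
  forall i, (deliver alpha beta pt f c).2 i <= M + tau.
Proof.
move=> cM i /=; rewrite /tau addrA; apply: lerD; last by case: (_ != _).
elim/big_ind: _ => [|x y xM yM|j _].
- by rewrite (le_trans (cM i)) // lerDl.
- by rewrite ge_max xM.
- by rewrite lerD2r ge_max !cM.
Qed.

Lemma foldl_deliver_time (V : Type) (pt : nat -> pattern p) (f : V -> V -> V)
    l c M :
  (forall i, c.2 i <= M) ->
  forall i, (foldl (fun c e => deliver alpha beta (pt e) f c) c l).2 i
            <= M + (size l)%:R * tau.
Proof.
elim: l c M => [|e l IH] c M cM i /=; first by rewrite mul0r addr0.
rewrite -addn1 natrD mulrDl mul1r [_ + tau]addrC addrA.
exact/IH/deliver_time.
Qed.

(** Reduction and broadcast take [up_log 2 p] steps each; [tau] is one message plus the unit of time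
    for combining. *)
Lemma collective_time (V : Type) (op : V -> V -> V) idx (val : 'I_p ->
  V) clk M :
  (forall i, clk i <= M) ->
  forall i, (collective alpha beta op idx val clk).2 i
            <= M + (2 * up_log 2 p)%:R * tau.
Proof.
move=> cM i; rewrite /= /all_reduce mul2n -addnn natrD mulrDl addrA.
have sd : size (distances (p := p)) = up_log 2 p by rewrite size_map size_iota.
rewrite -sd -{2}size_rev.
exact/foldl_deliver_time/foldl_deliver_time.
Qed.

End Machine.

Section Level.
Context {R : realType} (alpha beta : R) {d : Order.disp_t} {T : orderType d}.
Context {p : nat}.
Implicit Types (s : 'I_p ->
  seq T) (klo khi n : nat) (x : @draws p) (v : xobj T).

Definition pivot s klo khi n x : xobj T :=
  if from_front klo khi n then \big[xmin/PosInf]_i candidate_front (s i) (x i)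
  else \big[xmax/NegInf]_i candidate_back (s i) (x i).

Definition level_clocks s klo khi n x (clk : @clocks R p) : clocks :=
  let clk := elapse (fun=> 1%N) clk in
  let clk :=
    (if from_front klo khi n then
       collective alpha beta xmin PosInf
         (fun i => candidate_front (s i) (x i)) clk
     else
       collective alpha beta xmax NegInf
         (fun i => candidate_back (s i) (x i)) clk).2 in
  let v := pivot s klo khi n x in
  let clk := elapse (fun i => (locate (s i) v).2) clk in
  let clk := (collective alpha beta addn 0%N
                (fun i => (locate (s i) v).1) clk).2 in
  elapse (fun=> 1%N) clk.

Definition weight klo khi n x : R :=
  \prod_i geometric_pmf (success klo khi n : R) (x i).

Definition below s v i := [seq y <- s i | upto v y].
Definition above s v i := [seq y <- s i | ~~ upto v y].

(** On sorted sequences the cut at the located position is the cut by [upto v]. Replacing [take] and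
    [drop] by filters lets the recursion be followed on the global collection of objects. *)
Lemma amsSelect_cons x h s klo khi n clk w :
  (forall i, sorted <=%O (s i)) ->
  let v := pivot s klo khi n x in
  let k := count (upto v) (objects s) in
  let clk' := level_clocks s klo khi n x clk in
  let w' := w * weight klo khi n x in
  amsSelect alpha beta (x :: h) s klo khi n clk w =
  if (k < klo)%N then
    omap (prepend (below s v))
      (amsSelect alpha beta h (above s v) (klo - k) (khi - k) (n - k) clk' w')
  else if (khi < k)%N then amsSelect alpha beta h (below s v) klo khi k clk' w'
  else if h is [::] then Some (Run (below s v) clk' w') else None.
Proof.
move=> ss /=; rewrite /level_clocks /weight /pivot.
case: from_front => /=;
  [set v := \big[xmin/PosInf]_i _ | set v := \big[xmax/NegInf]_i _].
all: have -> : (\sum_i (locate (s i) v).1)%N = count (upto v) (objects s)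
  by rewrite count_objects; apply: eq_bigr => i _; case: (locateP v (ss i)).
all: have -> : (fun i => take (locate (s i) v).1 (s i)) = below s v
  by apply/funext => i; case: (locateP v (ss i)) => -> _;
     rewrite -down_closed_filter //; exact: upto_down.
all: have -> // : (fun i => drop (locate (s i) v).1 (s i)) = above s v.
all: apply/funext => i; case: (locateP v (ss i)) => -> _.
all: by rewrite -down_closed_filterC //; exact: upto_down.
Qed.

(** Induction on the trace: one predicate, common to all PEs, describes the output. It is joined
    with [upto v] when the pivot was too small and intersected with it when the pivot was too
    large. *)
Lemma amsSelect_selects h s klo khi n clk w r :
  (forall i, sorted <=%O (s i)) -> (klo <= khi)%N ->
  amsSelect alpha beta h s klo khi n clk w = Some r ->
  exists P : pred T, [/\ down_closed P,
    output r = fun i => [seq y <- s i | P y] &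
    (klo <= count P (objects s) <= khi)%N].
Proof.
elim: h s klo khi n clk w r => // x h IH s klo khi n clk w r ss kk.
rewrite amsSelect_cons //; set v := pivot _ _ _ _ _.
have sbelow i : sorted <=%O (below s v i) by exact: (sorted_filter le_trans).
have sabove i : sorted <=%O (above s v i) by exact: (sorted_filter le_trans).
case: ltnP => k1.
  case E: amsSelect => [r'|] //= [<-].
  have [|P [dP oE kP]] := IH _ _ _ _ _ _ _ sabove _ E; first exact: leq_sub2r.
  exists (fun y => upto v y || P y); split => [y z yz|/=|].
  - by case/orP => [/(upto_down yz) ->|/(dP _ _ yz) ->] //; rewrite orbT.
  - apply/funext => i;
      rewrite oE -[s i in RHS](cat_take_drop (count (upto v) (s i))).
    rewrite -down_closed_filter -?down_closed_filterC //; try exact: upto_down.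
    rewrite filter_cat; congr cat.
      by rewrite -filter_predI; apply: eq_filter => y /=; case: (upto v y);
        rewrite ?andbF.
    rewrite -!filter_predI; apply: eq_filter => y /=; case: (upto v y) => //=;
      rewrite ?andbF ?andbT //.
  - rewrite objects_filter in kP; rewrite count_filter in kP.
    rewrite (_ : count _ _ = (count (upto v) (objects s)
      + count (predI P (fun y => ~~ upto v y)) (objects s))%N); first lia.
    elim: (objects s) => //= y l ->.
    by case: (upto v y); case: (P y) => /=; lia.
case: ltnP => k2.
  move=> E; have [P [dP oE kP]] := IH _ _ _ _ _ _ _ sbelow kk E.
  exists (fun y => upto v y && P y); split => [y z yz|/=|].
  - by case/andP => /(upto_down yz) -> /(dP _ _ yz) ->.
  - by apply/funext => i; rewrite oE /below -filter_predI;
      apply: eq_filter => y /=; rewrite andbC.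
  - by rewrite objects_filter count_filter in kP;
      rewrite (eq_count (a2 := predI P (upto v))) // => y /=; rewrite andbC.
case: h {IH} => // -[<-] /=; exists (upto v); split=> //;
  first exact: upto_down.
by rewrite k1.
Qed.

End Level.

(** * Sums over countable types *)

Section Esum.
Context {R : realType}.
Local Open Scope classical_set_scope.
Local Open Scope ereal_scope.

Lemma subset_esum (T : choiceType) (A B : set T) (a : T -> \bar R) :
  A `<=` B -> \esum_(i in A) a i <= \esum_(i in B) a i.
Proof.
move=> AB; apply: ge_ereal_sup => _ [X [finX XA] <-].
by apply: ereal_sup_ubound; exists X => //; split=> // x /XA /AB.
Qed.

(** Every finite set of indices lies in one sublevel set of [m], so a bound uniform in [N] suffices.
    The measures used are the largest draw and the length of a trace. *)
Lemma esum_exhaust (T : choiceType) (m : T -> nat) (a : T ->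
  \bar R) (c : \bar R) :
  (forall N, \esum_(x in [set x | (m x <= N)%N]) a x <= c) ->
  \esum_(x in [set: T]) a x <= c.
Proof.
move=> ac; apply: ge_ereal_sup => _ [X [finX _] <-].
have /finite_seqP[l Xl] := finX.
apply: le_trans (ac (\max_(x <- l) m x)%N); apply: ereal_sup_ubound.
exists X => //; split=> // x; rewrite Xl => xl.
exact: (@leq_bigmax_seq _ l xpredT m x xl).
Qed.

Lemma esum_finType (F : finType) (a : F -> \bar R) :
  (forall y, 0 <= a y) -> \esum_(y in [set: F]) a y = \sum_y a y.
Proof.
have finF : finite_set [set: F] by exact: finite_finset.
move=> a0; rewrite esum_fset //.
rewrite (fsbig_finite _ _ finF); apply: perm_big.
apply: uniq_perm; rewrite ?fset_uniq ?index_enum_uniq // => y.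
by rewrite mem_index_enum in_fset_set ?mem_set.
Qed.

Lemma esumZl (T : choiceType) (A : set T) (k : R) (a : T ->
  \bar R) : (0 <= k)%R ->
  (forall x, 0 <= a x) ->
  \esum_(x in A) (k%:E * a x) = k%:E * \esum_(x in A) a x.
Proof.
(* One inequality suffices: the converse is the same inequality for the inverse factor. *)
have le_esumZl r (b : T -> \bar R) : (0 <= r)%R -> (forall x, 0 <= b x) ->
    \esum_(x in A) (r%:E * b x) <= r%:E * \esum_(x in A) b x.
  move=> r0 b0; apply: ge_ereal_sup => _ [X [finX XA] <-].
  rewrite -ge0_mule_fsumr // lee_wpmul2l ?lee_fin //.
  by apply: ereal_sup_ubound; exists X.
rewrite le_eqVlt => /predU1P[<- a0|k0 a0].
  by rewrite mul0e esum1 // => x _; rewrite mul0e.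
apply/eqP; rewrite eq_le; apply/andP; split; first by apply: le_esumZl;
  rewrite // ltW.
rewrite -lee_pdivlMl //.
apply: le_trans (le_esumZl k^-1%R (fun x => k%:E * a x) _ _).
- by apply: le_esum => x _; rewrite muleA -EFinM mulVf ?gt_eqF // mul1e.
- by rewrite invr_ge0 ltW.
- by move=> x; rewrite mule_ge0 // lee_fin ltW.
Qed.

(** On the box where all coordinates are at most [N] the sum is finite and factorizes by
    distributivity; the boxes exhaust all draws as [N] grows. *)
Lemma esum_prod (p : nat) (f : 'I_p -> nat -> R) (a : 'I_p -> R) :
  (forall i n, (0 <= f i n)%R) ->
  (forall i, (\sum_(n < N) f i n)%R @[N --> \oo] --> a i) ->
  \esum_(x in [set: {ffun 'I_p ->
    nat}]) (\prod_i f i (x i))%:E = (\prod_i a i)%:E.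
Proof.
move=> f0 fa.
have S_le i N : (\sum_(n < N) f i n <= a i)%R.
  have nd : nondecreasing_seq (fun N => \sum_(n < N) f i n)%R.
    by apply/nondecreasing_seqP => k; rewrite big_ord_recr lerDl.
  rewrite -(cvg_lim (@Rhausdorff R) (fa i)).
  by apply: (nondecreasing_cvgn_le nd); apply/cvg_ex; exists (a i).
have cvg_prod : (\prod_i \sum_(n < N) f i n)%R @[N --> \oo] --> (\prod_i a i)%R.
  elim: (index_enum _) => [|i r IH].
    by under eq_cvg do rewrite big_nil; rewrite big_nil; exact: cvg_cst.
  under eq_cvg do rewrite big_cons.
  by rewrite big_cons; apply: cvgM.
have box N : \esum_(x in [set x : {ffun 'I_p -> nat} | (\max_i x i <= N)%N])
    (\prod_i f i (x i))%:E = (\prod_i \sum_(n < N.+1) f i n)%:E.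
  pose e (y : {ffun 'I_p -> 'I_N.+1}) : {ffun 'I_p -> nat} :=
    [ffun i => y i : nat].
  rewrite (@reindex_esum _ _ _ [set: {ffun 'I_p -> 'I_N.+1}] _ e).
    rewrite esum_finType => [|y]; last by rewrite lee_fin prodr_ge0.
    rewrite sumEFin bigA_distr_bigA; congr _%:E; apply: eq_bigr => y _.
    by apply: eq_bigr => i _; rewrite ffunE.
  split.
  - by move=> y _ /=; apply/bigmax_leqP => i _; rewrite ffunE -ltnS.
  - by move=> y z _ _ /ffunP yz; apply/ffunP => i; apply: val_inj;
      have := yz i; rewrite !ffunE.
  - move=> x /= /bigmax_leqP xN; exists [ffun i => inord (x i)] => //.
    by apply/ffunP => i; rewrite !ffunE inordK // ltnS xN.
apply/eqP; rewrite eq_le; apply/andP; split.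
  apply: (@esum_exhaust _ (fun x : {ffun 'I_p -> nat} => \max_i x i)%N) => N.
  rewrite box lee_fin; apply: ler_prod => i _; rewrite S_le sumr_ge0 //.
(* For the lower bound, a single large box already comes within [e] of the limit. *)
apply/lee_subgt0Pr => e e0; rewrite -EFinB.
have [] := cvgr_ge _ cvg_prod (\prod_i a i - e)%R;
  first by rewrite ltrBlDr ltrDl.
move=> N _ /(_ N.+1 (leqnSn N)) /= h.
apply: le_trans (@subset_esum _ [set x : {ffun 'I_p ->
  nat} | (\max_i x i <= N)%N]
  _ _ (@subsetT _ _)).
by rewrite box lee_fin.
Qed.

Lemma esum_seqS (T : choiceType) n (a : seq T ->
  \bar R) : (forall h, 0 <= a h) ->
  \esum_(h in [set h | (size h <= n.+1)%N]) a h =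
  a [::] + \esum_(x in [set: T]) \esum_(h in [set h | (size h <= n)%N]) a (x ::
    h).
Proof.
move=> a0; rewrite (esumID [set [::]]) //; congr (_ + _).
  by rewrite setIidr ?esum_set1 // => _ ->.
rewrite esum_esum //.
rewrite (@reindex_esum _ _ _ ([set: T] `*`` fun=> [set h | (size h <= n)%N]) _
  (fun xh : T * seq T => xh.1 :: xh.2)) //.
split.
- by move=> [x h] /= [_ hn].
- by move=> [x h] [y g] _ _ /= [-> ->].
- by case=> [|x h] /= [hn hnil] //; exists (x, h).
Qed.

End Esum.

(** * Rank of the pivot *)

Section Pivot.
Context {d : Order.disp_t} {T : orderType d} {p : nat}.
Implicit Types (l : seq T) (s : 'I_p -> seq T) (D : pred T) (x : @draws p).

Lemma sub_count_lt (P Q : pred T) l y :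
  subpred P Q -> y \in l -> Q y -> ~~ P y -> (count P l < count Q l)%N.
Proof.
move=> PQ yl Qy nPy; have := sub_count PQ.
elim: l yl => //= z l IH; rewrite inE => /predU1P[<- h|/IH {}IH h].
  by rewrite Qy (negbTE nPy) add0n add1n ltnS h.
by rewrite -addnS leq_add ?IH //; case Pz: (P z) => //; rewrite PQ.
Qed.

Lemma onth_down_closed_rev D l i : down_closed D -> sorted <=%O l ->
  (if onth (rev l) i is Some y then ~~ D y else false)
  = (i < count (predC D) l)%N.
Proof.
move=> dD sl; have := count_predC D l.
case: l sl => [|x0 l] sl ; first by rewrite onthE /= nth_nil.
move: (x0 :: l) sl => {}l sl cl.
case: (ltnP i (size l)) => il; last first.
  rewrite onthE nth_default ?size_map ?size_rev //; apply/esym/negbTE.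
  by rewrite -leqNgt; lia.
have := onth_down_closed (size l - i.+1) dD sl.
rewrite !onthE !(nth_map x0) ?size_rev ?nth_rev ?ltn_subrL //=; last by lia.
by move=> ->; apply/idP/idP; lia.
Qed.

Lemma upto_xmin (u v : xobj T) z : upto (xmin u v) z = upto u z && upto v z.
Proof.
rewrite /upto /xmin; case: u => [|u|]; case: v => [|v|] //=;
  rewrite ?andbT ?andbF //.
case: leP => uv; apply/idP/andP => [zu|[]//].
  by split=> //; apply: le_trans uv.
by split=> //; apply/ltW/(le_lt_trans zu).
Qed.

Lemma upto_xmax (u v : xobj T) z : upto (xmax u v) z = upto u z || upto v z.
Proof.
rewrite /upto /xmax; case: u => [|u|]; case: v => [|v|] //=;
  rewrite ?orbT ?orbF //.
case: leP => uv; apply/idP/orP => [zu|[]//].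
- by right.
- by move=> zu; apply: le_trans uv.
- by left.
- by move=> zv; apply/ltW/(le_lt_trans zv).
Qed.

(** The pivot is the minimum of the candidates, so it lies beyond [D] exactly when every PE skips
    all of its own objects in [D]. *)
Lemma count_pivot_front D s x : down_closed D ->
  (forall i, sorted <=%O (s i)) ->
  (count D (objects s) < size (objects s))%N ->
  (count D (objects s) <
   count (upto (\big[xmin/PosInf]_i candidate_front (s i) (x i))) (objects s))%N
  = [forall i, (count D (s i) <= (x i).-1)%N].
Proof.
move=> dD ss Ds; set v := \big[_/_]_i _.
have uv z : upto v z = [forall i, upto (candidate_front (s i) (x i)) z].
  by rewrite /v (big_morph (upto^~ z) (fun u v => upto_xmin u v z) erefl)
    big_andE.
apply/idP/forallP => [|h].
  move=> + i; rewrite [in X in _ -> X]leqNgt -(onth_down_closed _ dD) //.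
  apply: contraLR; rewrite negbK; case E: onth => [y|//] Dy; rewrite -leqNgt;
    apply: sub_count => z.
  rewrite uv => /forallP/(_ i); rewrite /upto /candidate_front E => /= zy.
  exact: dD Dy.
have: v = PosInf \/ exists y, [/\ v = Obj y, ~~ D y & y \in objects s].
  rewrite /v; elim/big_ind: _ => [|u w|i _]; first by left.
    by rewrite /xmin; case: xle.
  rewrite /candidate_front; case E: onth => [y|]; last by left.
  right; exists y; split => //; last first.
    by apply: (@mem_objects _ _ _ _ i);
      rewrite -(@onth_nth _ y _ _ _ E) mem_nth // -onthTE E.
  have := onth_down_closed (x i).-1 dD (ss i); rewrite E => ->.
  by rewrite -leqNgt.
(* If no PE has a candidate, the pivot [PosInf] has rank [size (objects s)]; the strict bound on
   [count D] enters here. *)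
case=> [->|[y [-> nDy ys]]]; first by rewrite [X in (_ < X)%N]count_predT.
apply: (sub_count_lt _ ys) => //=; last exact: lexx.
by move=> z Dz; rewrite /upto /=; case: leP => // /ltW yz;
  rewrite (dD _ _ yz Dz) in nDy.
Qed.

(** Mirror image: the maximum of the candidates has rank at most [count D] exactly when every PE
    skips, from the back, all of its objects outside [D]. The default [NegInf] has rank 0. *)
Lemma count_pivot_back D s x : down_closed D -> (forall i, sorted <=%O (s i)) ->
  (count (upto (\big[xmax/NegInf]_i candidate_back (s i) (x i))) (objects s)
   <= count D (objects s))%N
  = [forall i, (count (predC D) (s i) <= (x i).-1)%N].
Proof.
move=> dD ss; set v := \big[_/_]_i _.
have uv z : upto v z = [exists i, upto (candidate_back (s i) (x i)) z].
  by rewrite /v (big_morph (upto^~ z) (fun u v => upto_xmax u v z) erefl)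
    big_orE.
apply/idP/forallP => [|h].
  move=> + i; rewrite [in X in _ -> X]leqNgt -(onth_down_closed_rev _ dD) //.
  apply: contraLR; rewrite negbK; case E: onth => [y|//] nDy; rewrite -ltnNge.
  apply: (@sub_count_lt _ _ _ y) => //.
  - move=> z Dz; rewrite uv; apply/existsP; exists i.
    rewrite /candidate_back E /upto /=; case: leP => // /ltW yz.
    by rewrite (dD _ _ yz Dz) in nDy.
  - by apply: (@mem_objects _ _ _ _ i);
      rewrite -mem_rev -(@onth_nth _ y _ _ _ E) mem_nth // -onthTE E.
  - by rewrite uv; apply/existsP; exists i; rewrite /candidate_back E /upto /=.
apply: sub_count => z; rewrite uv => /existsP[i]; rewrite /candidate_back.
have := onth_down_closed_rev (x i).-1 dD (ss i).
case: onth => [y|//]; rewrite ltnNge h => /negbFE Dy zy; exact: dD zy Dy.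
Qed.

End Pivot.

(** * Geometric draws and expectations over one level *)

Section Geometric.
Local Open Scope classical_set_scope.
Local Open Scope ring_scope.
Context {R : realType}.

Lemma geometric_pmf_ge0 (theta : R) n : 0 <= theta <= 1 ->
  0 <= geometric_pmf theta n.
Proof.
by case: n => //= n /andP[t0 t1]; rewrite mulr_ge0 // exprn_ge0 // subr_ge0.
Qed.

(** Here [n.-1] counts the failures before the first success. The first [m.+1] terms vanish, and the
    shifted partial sums have a closed form that tends to the tail. *)
Lemma geometric_tail (theta : R) m : 0 < theta <= 1 ->
  \sum_(n < N) geometric_pmf theta n * (m <= n.-1)%:R @[N --> \oo]
  --> (1 - theta) ^+ m.
Proof.
move=> /andP[t0 t1]; rewrite -(cvg_shiftn m.+1).
have q1 : `|1 - theta| < 1 by rewrite ger0_norm ?subr_ge0 // ltrBlDr ltrDl.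
have sumE N : \sum_(n < N + m.+1) geometric_pmf theta n * (m <= n.-1)%:R
    = (1 - theta) ^+ m - (1 - theta) ^+ m * (1 - theta) ^+ N.
  elim: N => [|N IH].
    rewrite mulr1 subrr add0n big1 // => -[[|n] /= nm] _;
      first by rewrite mul0r.
    by rewrite leqNgt -ltnS nm mulr0.
  rewrite addSn big_ord_recr /= IH addnS /= leq_addl mulr1 exprD exprS; ring.
under eq_cvg do rewrite /= sumE.
have : (1 - theta) ^+ m - (1 - theta) ^+ m * (1 - theta) ^+ N @[N --> \oo]
    --> (1 - theta) ^+ m - (1 - theta) ^+ m * 0.
  by apply: cvgB; [exact: cvg_cst|apply: cvgM;
    [exact: cvg_cst|exact: cvg_expr]].
by rewrite mulr0 subr0.
Qed.

Section Expectation.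
Variables (p : nat) (theta : R).
Hypothesis theta01 : 0 < theta <= 1.

Definition draw_mean (g : @draws p -> R) : \bar R :=
  (\esum_(x in [set: @draws p]) ((\prod_i geometric_pmf theta (x i)) * g
    x)%:E)%E.

Lemma weight_ge0 (x : @draws p) : 0 <= \prod_i geometric_pmf theta (x i).
Proof.
by apply: prodr_ge0 => i _; apply: geometric_pmf_ge0;
  case/andP: theta01 => /ltW ->.
Qed.

Lemma draw_meanD g h : (forall x, 0 <= g x) -> (forall x, 0 <= h x) ->
  draw_mean (fun x => g x + h x) = (draw_mean g + draw_mean h)%E.
Proof.
move=> g0 h0; rewrite /draw_mean -esumD; last 2 first.
- by move=> x _; rewrite lee_fin mulr_ge0 // weight_ge0.
- by move=> x _; rewrite lee_fin mulr_ge0 // weight_ge0.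
by apply: eq_esum => x _; rewrite mulrDr.
Qed.

Lemma draw_meanZ k g : 0 <= k -> (forall x, 0 <= g x) ->
  draw_mean (fun x => k * g x) = (k%:E * draw_mean g)%E.
Proof.
move=> k0 g0; rewrite /draw_mean -esumZl //.
  by apply: eq_esum => x _; rewrite -EFinM mulrCA.
by move=> x; rewrite lee_fin mulr_ge0 // weight_ge0.
Qed.

Lemma le_draw_mean g h : (forall x, g x <= h x) ->
  (draw_mean g <= draw_mean h)%E.
Proof. by move=> gh; apply: le_esum => x _;
  rewrite lee_fin ler_wpM2l ?weight_ge0. Qed.

Lemma eq_draw_mean g h : g =1 h -> draw_mean g = draw_mean h.
Proof. by move=> gh; apply: eq_esum => x _; rewrite gh. Qed.

(** By independence the tails multiply and their exponents add up, so only the total number of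
    skipped objects matters and not how they are distributed over the PEs. *)
Lemma draw_mean_tail (m : 'I_p -> nat) :
  draw_mean (fun x => [forall i, m i <= (x i).-1]%N%:R)
  = ((1 - theta) ^+ (\sum_i m i)%N)%:E.
Proof.
rewrite -prodrXr -(esum_prod (f :=
  fun i n => geometric_pmf theta n * (m i <= n.-1)%:R)).
- apply: eq_esum => x _; rewrite big_split /=; congr (_ * _)%:E.
  case: forallP => [h|/forallP/forallPn[i ni]];
    first by rewrite big1 // => i _; rewrite h.
  by rewrite (bigD1 i) //= (negbTE ni) mul0r.
- by move=> i n; rewrite mulr_ge0 // geometric_pmf_ge0 //;
    case/andP: theta01 => /ltW ->.
- by move=> i; exact: geometric_tail.
Qed.

Lemma draw_mean_cst k : 0 <= k -> draw_mean (fun=> k) = k%:E.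
Proof.
move=> k0; transitivity (k%:E * draw_mean (fun=> 1%R))%E.
  by rewrite -draw_meanZ //; apply: eq_draw_mean => x; rewrite mulr1.
(* Total mass 1 is the tail event with threshold 0 on every PE. *)
rewrite (@eq_draw_mean _ (fun x => [forall i, 0 <= (x i).-1]%N%:R)).
  by rewrite draw_mean_tail big1 ?mule1.
by move=> x; case: forallP.
Qed.

End Expectation.

End Geometric.

(** * Probability of stopping *)

Section Success.
Context {R : realType}.
Implicit Types (q c : R).

Lemma powR_root (r : R) m : 0 <= r < 1 -> (0 < m)%N ->
  let q := r `^ m%:R^-1 in 0 <= q < 1 /\ q ^+ m = r.
Proof.
move=> /andP[r0 r1] m0 q; have q0 : 0 <= q by exact: powR_ge0.
have qm : q ^+ m = r.
  by rewrite -powR_mulrn // /q -powRrM mulVf ?powRr1 // pnatr_eq0 -lt0n.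
split=> //; rewrite q0 /= ltNge; apply/negP => /(exprn_ege1 m).
by rewrite qm leNgt r1.
Qed.

(** In terms of [a] and [K] alone this is [(a / K) ^ (a / (K - a)) >= 1 / e], a consequence of
    [ln (K / a) <= K / a - 1]. *)
Lemma root_power_ge q a K : (0 < a)%N -> (a < K)%N -> 0 <= q ->
  q ^+ (K - a) = a%:R / K%:R -> expR (-1) <= q ^+ a.
Proof.
move=> a0 aK; rewrite le_eqVlt => /predU1P[<- /esym/eqP|q0 qE].
  by rewrite expr0n subn_eq0 leqNgt aK /= mulf_eq0 invr_eq0 !pnatr_eq0; lia.
have a0R : 0 < a%:R :> R by rewrite ltr0n.
have K0R : 0 < K%:R :> R by rewrite ltr0n; lia.
have Ka0 : 0 < (K - a)%:R :> R by rewrite ltr0n subn_gt0.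
have lnq : - (a%:R^-1) <= ln q.
  rewrite -(ler_pM2l Ka0) [leRHS]mulr_natl -lnXn // qE -[a%:R / _]invf_div lnV;
    last first.
    by rewrite posrE divr_gt0.
  rewrite mulrN lerN2 -[X in ln X](subrK 1) addrC.
  apply: le_trans (le_ln1Dx _) _; first by rewrite ltrBrDr addNr divr_gt0.
  by rewrite natrB 1?ltnW // mulrBl mulfV ?gt_eqF.
have -> : q ^+ a = expR (ln q *+ a) by rewrite -lnXn // lnK // posrE exprn_gt0.
rewrite ler_expR -mulr_natl; have := ler_wpM2l (ltW a0R) lnq.
by rewrite mulrN mulfV ?gt_eqF.
Qed.

(* The ranks [a + 1, ..., K] make the search stop; [q] is chosen so that their
   probability [q ^ a - q ^ K] is largest. *)
Lemma success_probability q c a K : (a < K)%N -> 0 <= q ->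
  q ^+ (K - a) = a%:R / K%:R -> 0 <= c -> c * K%:R <= (K - a)%:R ->
  expR (-1) * c <= q ^+ a - q ^+ K.
Proof.
move=> aK q0 qE c0 cK.
have K0R : 0 < K%:R :> R by rewrite ltr0n; lia.
rewrite -[X in _ - q ^+ X](subnKC (ltnW aK)) exprD qE -{1}[q ^+ a]mulr1 -mulrBr.
have ce : c <= 1 - a%:R / K%:R.
  rewrite -(ler_pM2r K0R) mulrBl mul1r divfK ?gt_eqF //.
  by rewrite -natrB 1?ltnW.
apply: ler_pM => //.
case: (posnP a) => [->|a0]; last exact: root_power_ge qE.
by rewrite expr0 -expR0 ler_expR oppr_le0.
Qed.

Lemma one_sub_expr_le q m : 0 <= q <= 1 -> 1 - q ^+ m <= m%:R * (1 - q).
Proof.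
move=> /andP[q0 q1]; elim: m => [|m IH]; first by rewrite subrr mul0r.
have : q ^+ m * (1 - q) <= 1 - q.
  by rewrite -[leRHS]mul1r ler_wpM2r ?subr_ge0 // exprn_ile1.
by rewrite exprSr -natr1 mulrDl mul1r mulrBr mulr1; lra.
Qed.

Lemma geometric_sum_le q n : 0 <= q < 1 -> \sum_(m < n) q ^+ m <= (1 - q)^-1.
Proof.
move=> /andP[q0 q1]; have t0 : 0 < 1 - q by rewrite subr_gt0.
rewrite -(ler_pM2l t0) mulfV ?gt_eqF // -opprB mulNr -subrX1 opprB.
by rewrite gerBl exprn_ge0.
Qed.

End Success.

Lemma sum_ltn k n : (k <= n)%N -> (\sum_(m < n) (m < k) = k)%N.
Proof.
move=> kn; transitivity (minn k n); last lia.
elim: n {kn} => [|n IH]; first by rewrite big_ord0 minn0.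
by rewrite big_ord_recr /= IH; lia.
Qed.

(** * Stopping probability and mean rank at one level *)

Section Level.
Context {R : realType} {d : Order.disp_t} {T : orderType d} {p : nat}.
Variables (c : R) (s : 'I_p -> seq T) (klo khi : nat).
Local Notation n := (size (objects s)).
Hypothesis c_gt0 : 0 < c.
Hypothesis kk : (0 < klo <= khi)%N.
Hypothesis kn : (klo <= n)%N.
Hypothesis ck : c * khi%:R <= (khi - klo)%:R.

Let theta : R := success klo khi n.
(** The search stops when the rank, counted from the sampled end, lies in [a + 1, ..., K]; from the
    back this rank is [n - k + 1]. Truncated subtraction gives [a = 0] when [n < khi]. *)
Let a := if from_front klo khi n then klo.-1 else (n - khi)%N.
Let K := if from_front klo khi n then khi else (n - klo).+1.
Let k x := count (upto (pivot s klo khi n x)) (objects s).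

Lemma gap_le1 : c <= 1.
Proof.
have k0 : 0 < khi%:R :> R by rewrite ltr0n; lia.
rewrite -(ler_pM2r k0) mul1r (le_trans ck) // ler_nat; lia.
Qed.

Lemma success_spec : [/\ 0 < theta <= 1, (a < K)%N,
  (1 - theta) ^+ (K - a) = a%:R / K%:R & c * K%:R <= (K - a)%:R].
Proof.
have aK : (a < K)%N by rewrite /a /K; case: ifP; lia.
have r01 : 0 <= (a%:R / K%:R : R) < 1.
  by rewrite divr_ge0 //= ltr_pdivrMr ?mul1r ?ltr_nat // ltr0n; lia.
have thetaE : 1 - theta = (a%:R / K%:R) `^ (khi - klo).+1%:R^-1.
  by rewrite /theta /success /a /K; case: ifP => _; rewrite opprB addrC subrK.
have [/andP[q0 q1] qE] := @powR_root R _ (khi - klo).+1 r01 isT.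
rewrite -!thetaE in q0 q1 qE.
split=> //; first by apply/andP; split; lra.
  (* For [a > 0] the window has length [khi - klo + 1]. For [a = 0] the length may differ, but then
     [1 - theta = 0] and any positive exponent gives 0. *)
  case: (posnP a) => [a0|a0]; last by rewrite -qE; congr (_ ^+ _); move: a0;
    rewrite /a /K /from_front; case: ifP; lia.
  rewrite a0 subn0 mul0r; move: qE; rewrite a0 mul0r => /eqP.
  by rewrite expf_eq0 => /andP[_ /eqP ->]; rewrite expr0n; case: eqP => //; lia.
have c1 := gap_le1.
case: (ltnP n khi) => [nk|nk].
  have a0 : a = 0%N by move: nk; rewrite /a /from_front; case: ifP; lia.
  by rewrite a0 subn0 ler_piMl.
have -> : (K - a = (khi - klo).+1)%N by move: nk; rewrite /a /K /from_front;
  case: ifP; lia.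
(* Sampling from the back requires [n <= klo + khi], hence [K <= khi + 1] in both cases; the
   additional [c] is covered by [c <= 1]. *)
rewrite -natr1; apply: le_trans (_ : c * (khi%:R + 1) <= _).
  rewrite ler_pM2l // natr1 ler_nat; rewrite /K /from_front; case: ifP; lia.
by rewrite mulrDr mulr1 lerD.
Qed.

Let theta01 : 0 < theta <= 1.
Proof. by case: success_spec. Qed.

Hypothesis us : uniq (objects s).
Hypothesis ss : forall i, sorted <=%O (s i).

Lemma tail_front m : from_front klo khi n -> (m < n)%N ->
  draw_mean theta (fun x => (m < k x)%N%:R) = ((1 - theta) ^+ m)%:E.
Proof.
move=> ff mn; have [D dD cD] := down_closed_count us (ltnW mn).
rewrite -[in RHS]cD count_objects -draw_mean_tail //; apply: eq_draw_mean => x.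
by rewrite -count_pivot_front ?cD // /k /pivot ff.
Qed.

Lemma tail_back m : ~~ from_front klo khi n -> (m <= n)%N ->
  draw_mean theta (fun x => (k x <= n - m)%N%:R) = ((1 - theta) ^+ m)%:E.
Proof.
move=> ff mn; have [D dD cD] := down_closed_count us (leq_subr m n).
have mE : m = (\sum_i count (predC D) (s i))%N.
  by rewrite -count_objects; have := count_predC D (objects s); lia.
rewrite [in RHS]mE -draw_mean_tail //; apply: eq_draw_mean => x.
by rewrite -count_pivot_back // cD /k /pivot (negbTE ff).
Qed.

(** The tail events at [a] and [K] are nested and differ by the event of stopping, whose probability
    is therefore [q ^ a - q ^ K] with [q = 1 - theta]. *)
Lemma draw_mean_continue :
  (draw_mean theta (fun x => (~~ (klo <= k x <= khi))%N%:R)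
   <= (1 - expR (-1) * c)%:E)%E.
Proof.
have [_ aK qE cK] := success_spec.
have stop : (draw_mean theta (fun x => (klo <= k x <= khi)%N%:R)
    + ((1 - theta) ^+ K)%:E = ((1 - theta) ^+ a)%:E)%E.
  rewrite /a /K; case: ifPn => ff.
    have [fk fn] : (khi < n)%N /\ (klo.-1 < n)%N by move: ff;
      rewrite /from_front; lia.
    rewrite -!tail_front // -draw_meanD //; apply: eq_draw_mean => x.
    by rewrite -natrD; congr _%:R; lia.
  rewrite -!tail_back; [|exact: ff|lia|exact: ff|lia].
  rewrite -draw_meanD //; apply: eq_draw_mean => x.
  have : (k x <= n)%N by exact: count_size.
  by rewrite -natrD => kxn; congr _%:R; lia.
have total : (draw_mean theta (fun x => (klo <= k x <= khi)%N%:R)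
   + draw_mean theta (fun x => (~~ (klo <= k x <= khi))%N%:R) = 1)%E.
  rewrite -draw_meanD // -[RHS](draw_mean_cst p theta01) //.
  by apply: eq_draw_mean => x; case: (_ <= _ <= _)%N; rewrite ?addr0 ?add0r.
have := success_probability aK _ qE (ltW c_gt0) cK.
move: stop total; set e := draw_mean _ _; set e' := draw_mean _ _.
case: e => [e| |] //; case: e' => [e'| |] //; rewrite -!EFinD => -[sE] [tE].
case/andP: theta01 => _ t1 /(_ _) h; have {}h := h (ltac:(rewrite subr_ge0 //)).
by rewrite lee_fin; lra.
Qed.

(** From the front, the mean is a sum of tails, at most [1 / theta]; and
    [c <= 1 - q ^ (K - a) <= (K - a) * theta] by Bernoulli's inequality, so [theta >= c / khi]. *)
Lemma draw_mean_rank :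
  (draw_mean theta (fun x => (k x)%:R) <= (2 * khi%:R / c)%:E)%E.
Proof.
have c1 := gap_le1; have [_ aK qE cK] := success_spec.
have k0 : 0 < khi%:R :> R by rewrite ltr0n; lia.
case: (boolP (from_front klo khi n)) => ff.
  have -> : draw_mean theta (fun x => (k x)%:R)
      = (\sum_(m < n) (1 - theta) ^+ m)%:E.
    rewrite -sumEFin; under [RHS]eq_bigr do rewrite -tail_front //.
    rewrite /draw_mean -esum_sum; last first.
      by move=> x m _ _; rewrite lee_fin mulr_ge0 // weight_ge0.
    apply: eq_esum => x _; rewrite sumEFin -mulr_sumr; congr (_ * _)%:E.
    by rewrite -natr_sum sum_ltn // count_size.
  have [t0 t1] := andP theta01.
  rewrite lee_fin; apply: le_trans (geometric_sum_le _ _) _.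
    by rewrite subr_ge0 t1 ltrBlDr ltrDl.
  rewrite subKr.
  have KE : K = khi by rewrite /K ff.
  have q01 : 0 <= 1 - theta <= 1 by rewrite subr_ge0 t1 lerBlDr lerDl ltW.
  have := one_sub_expr_le (K - a) q01; rewrite qE subKr => h.
  have cK' : c <= 1 - a%:R / K%:R.
    have K0 : 0 < K%:R :> R by rewrite KE.
    rewrite -(ler_pM2r K0) mulrBl mul1r divfK ?gt_eqF //.
    by rewrite -natrB 1?ltnW.
  have ct : c <= khi%:R * theta.
    apply: le_trans cK' (le_trans h _).
    by rewrite ler_pM2r // ler_nat -KE leq_subr.
  rewrite -[leLHS]mul1r ler_pdivrMr // mulrAC ler_pdivlMr // mul1r.
  apply: (le_trans ct); apply: ler_wpM2r; [exact: ltW|lra].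
(* From the back, [n <= klo + khi <= 2 * khi] bounds the rank for every draw. *)
have kx x : (k x)%:R <= 2 * khi%:R :> R.
  rewrite -natrM ler_nat; apply: leq_trans (count_size _ _) _.
  by move: ff; rewrite /from_front; lia.
apply: le_trans (le_draw_mean theta01 kx) _.
rewrite draw_mean_cst // ?mulr_ge0 // lee_fin ler_pdivlMr //.
by rewrite ler_piMr // mulr_ge0.
Qed.


End Level.

(** * Expectations over the whole execution *)

Section Recursion.
Local Open Scope classical_set_scope.
Local Open Scope ring_scope.
Context {R : realType} {d : Order.disp_t} {T : orderType d} {p : nat}.
Variables (alpha beta c : R) (K0 : nat).
Hypothesis c_gt0 : 0 < c.
Hypothesis time_ge0 : 0 <= message_time alpha beta 1.
Implicit Types (s : 'I_p ->
  seq T) (klo khi n : nat) (x : @draws p) (clk : @clocks R p).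
Implicit Types (w M : R) (f : @run R d T p -> R).

(** Invariant of the recursion. The gap [khi - klo] never changes while [khi] can only shrink, so
    the ratio condition persists; [K0] bounds every later [khi] and gives one time bound for all
    levels. *)
Definition valid s klo khi n := [/\ n = size (objects s), 
  uniq (objects s) /\ (forall i, sorted <=%O (s i)), (0 < klo <= khi)%N,
  (klo <= n)%N /\ (khi <= K0)%N & c * khi%:R <= (khi - klo)%:R].

Definition rank s klo khi n x := count (upto (pivot s klo khi n x)) (objects s).

Lemma valid_above s klo khi n v : let k := count (upto v) (objects s) in
  valid s klo khi n -> (k < klo)%N ->
  valid (above s v) (klo - k) (khi - k) (n - k).
Proof.
move=> k [nE [us ss] kk [kn kK] ck] k_lt.
have oE : objects (above s v) = [seq y <- objects s | ~~ upto v y]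
  by exact: objects_filter.
split; [|split| |split|]; rewrite ?oE ?filter_uniq //; try lia.
- by rewrite size_filter nE -(count_predC (upto v)) addKn.
- by move=> i; apply: sorted_filter => //; exact: le_trans.
- have -> : (khi - k - (klo - k) = khi - klo)%N by lia.
  by apply: le_trans ck; rewrite ler_pM2l // ler_nat leq_subr.
Qed.

Lemma valid_below s klo khi n v : let k := count (upto v) (objects s) in
  valid s klo khi n -> (khi < k)%N -> valid (below s v) klo khi k.
Proof.
move=> k [nE [us ss] kk [kn kK] ck] k_gt.
have oE : objects (below s v) = [seq y <- objects s | upto v y]
  by exact: objects_filter.
split; [|split| |split|]; rewrite ?oE ?filter_uniq ?size_filter //; try lia.
by move=> i; apply: sorted_filter => //; exact: le_trans.
Qed.

Lemma valid_gt0 s klo khi n : valid s klo khi n -> (0 < K0)%N.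
Proof.
by case=> _ _ /andP[k0 kk] [_ kK] _; exact: leq_trans (leq_trans k0 kk) kK.
Qed.

Lemma valid_success s klo khi n : valid s klo khi n ->
  0 < (success klo khi n : R) <= 1.
Proof.
by case=> -> [us ss] kk [kn _] ck; case: (success_spec c_gt0 kk kn ck).
Qed.

Lemma weight_valid s klo khi n x : valid s klo khi n ->
  0 <= (weight klo khi n x : R).
Proof. by move=> /valid_success ?; exact: weight_ge0. Qed.

Lemma likelihood_ge0 h s klo khi n clk w r : valid s klo khi n -> 0 <= w ->
  amsSelect alpha beta h s klo khi n clk w = Some r -> 0 <= likelihood r.
Proof.
elim: h s klo khi n clk w r => // x h IH s klo khi n clk w r V w0.
have [_ [_ ss] _ _ _] := V; rewrite amsSelect_cons //=.
have w0' : 0 <= w * weight klo khi n x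
  by rewrite mulr_ge0 // (weight_valid _ V).
case: ltnP => k1.
  by case E: amsSelect => [r'|] //= [<-] /=; apply: IH E => //;
    exact: (valid_above V k1).
case: ltnP => k2; first by apply: IH => //; exact: (valid_below V k2).
by case: h {IH} => // -[<-].
Qed.

Definition contribution f s klo khi n clk w h : \bar R :=
  (if amsSelect alpha beta h s klo khi n clk w is Some r
   then (likelihood r * f r)%:E else 0)%E.

(** Restriction to executions of at most [N] levels, which permits induction on [N]; the full mean
    is recovered by exhaustion. *)
Definition truncated_mean N f s klo khi n clk w : \bar R :=
  (\esum_(h in [set h : seq (@draws p) | (size h <= N)%N])
     contribution f s klo khi n clk w h)%E.

Section Observable.
Variable f : @run R d T p -> R.
Hypothesis f_ge0 : forall r, 0 <= f r.
Hypothesis f_prepend : forall o r, f (prepend o r) = f r.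

Lemma contribution_ge0 s klo khi n clk w h : valid s klo khi n -> 0 <= w ->
  (0 <= contribution f s klo khi n clk w h)%E.
Proof.
move=> V w0; rewrite /contribution; case E: amsSelect => [r|] //.
by rewrite lee_fin mulr_ge0 // (likelihood_ge0 V w0 E).
Qed.

Lemma truncated_mean0 s klo khi n clk w :
  truncated_mean 0 f s klo khi n clk w = 0%E.
Proof. by apply: esum1 => -[|x h]. Qed.

(** Conditioning on the first draw. Prepending the elements already selected is invisible to [f]. *)
Lemma truncated_meanS N s klo khi n clk w : valid s klo khi n -> 0 <= w ->
  truncated_mean N.+1 f s klo khi n clk w =
  (\esum_(x in [set: @draws p])
    let v := pivot s klo khi n x in
    let k := rank s klo khi n x in
    let clk' := level_clocks alpha beta s klo khi n x clk in
    let w' := (w * weight klo khi n x)%R in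
    if (k < klo)%N then
      truncated_mean N f (above s v) (klo - k) (khi - k) (n - k) clk' w'
    else if (khi < k)%N then truncated_mean N f (below s v) klo khi k clk' w'
    else (w' * f (Run (below s v) clk' w'))%R%:E)%E.
Proof.
move=> V w0; have [_ [_ ss] _ _ _] := V; rewrite /truncated_mean esum_seqS;
  last first.
  by move=> h; exact: contribution_ge0.
rewrite [X in (X + _)%E]/contribution /= add0e; apply: eq_esum => x _.
have w0' : 0 <= w * weight klo khi n x
  by rewrite mulr_ge0 // (weight_valid _ V).
under eq_esum do rewrite /contribution amsSelect_cons //.
rewrite /= -/(rank s klo khi n x); case: ifP => k1.
  by apply: eq_esum => h _; rewrite /contribution; case: amsSelect => //= r;
    rewrite f_prepend.
case: ifP => k2 //.
(* Once the search stops, only the empty remaining trace contributes. *)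
rewrite (esumID [set [::]]); last first.
  by case=> [|y h] _ //=; rewrite lee_fin mulr_ge0.
rewrite setIidr; last by move=> _ ->.
rewrite esum_set1 /=; last by rewrite lee_fin mulr_ge0.
rewrite [X in (_ + X)%E]esum1 ?adde0 //.
by case=> [|y h] [_ nil] //; case: nil.
Qed.

End Observable.

Let tau := message_time alpha beta 1 + 1.
Let round_trip := (2 * up_log 2 p)%:R * tau.
(* The logarithm of the rank is replaced by its tangent at [K0], so that only the
   mean rank matters. *)
Let base : R := 2 + 2 * round_trip + (ln 16 + 2 * ln K0%:R + 2) / ln 2.
Let slope : R := 2 / (K0%:R * ln 2).
(** Lower bound on the probability that a level is the last one. *)
Let delta := expR (-1) * c.
(** The second summand is [slope] times the bound [2 * K0 / c] on the mean rank. *)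
Definition level_mean := base + 4 / (c * ln 2).

Let ln2_gt0 : 0 < ln 2 :> R.
Proof. by rewrite ln_gt0 // ltr1n. Qed.

Lemma locate_time (l : seq T) v : sorted <=%O l ->
  (locate l v).2%:R <= (ln 16 + 2 * ln (count (upto v) l).+1%:R) / ln 2 :> R.
Proof.
move=> /(locateP v)[_]; set j := count _ _; set t := (locate l v).2 => tj.
rewrite ler_pdivlMr // mulr_natl -lnXn ?ltr0n // mulr_natl -lnXn ?ltr0n //.
rewrite -lnM ?posrE ?exprn_gt0 ?ltr0n // ler_ln ?posrE ?mulr_gt0 ?exprn_gt0
  ?ltr0n //.
by rewrite -!natrX -natrM ler_nat.
Qed.

Lemma level_time s klo khi n x clk M : valid s klo khi n ->
  (forall i, clk i <= M) -> forall i,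
  level_clocks alpha beta s klo khi n x clk i
  <= M + (base + slope * (rank s klo khi n x)%:R).
Proof.
move=> V cM i; have K00 := valid_gt0 V; have [_ [_ ss] _ _ _] := V.
rewrite /level_clocks.
set v := pivot _ _ _ _ _; set k := rank _ _ _ _ _.
have K0R : 0 < K0%:R :> R by rewrite ltr0n.
have K1R : 1 <= K0%:R :> R by rewrite ler1n.
pose loc : R := (ln 16 + 2 * ln k.+1%:R) / ln 2.
have locM (clk0 : @clocks R p) M0 : (forall j, clk0 j <= M0) ->
    forall j, elapse (fun i => (locate (s i) v).2) clk0 j <= M0 + loc.
  move=> clkM0 j; apply: lerD; first exact: clkM0.
  apply: le_trans (locate_time v (ss j)) _.
  rewrite ler_pM2r ?invr_gt0 // lerD2l ler_pM2l // ler_ln ?posrE ?ltr0n //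
    ler_nat ltnS.
  (* A local count is one summand of the global rank, so a single bound serves all PEs. *)
  by rewrite /k /rank -/v count_objects (bigD1 j) //= leq_addr.
apply: le_trans (_ : M + 1 + round_trip + loc + round_trip + 1 <= _).
  rewrite {1}/elapse lerD2r; apply: collective_time => // j.
  apply: locM => {}j;
    have cM1 i' : elapse (fun=> 1%N) clk i' <= M + 1 by rewrite lerD2r.
  by case: from_front; exact: collective_time.
(* Uses [ln u < u] for [u = (k + 1) / K0], then [1 / K0 <= 1]. *)
have lnk : ln k.+1%:R <= ln K0%:R + 1 + k%:R / K0%:R :> R.
  have u0 : 0 < k.+1%:R / K0%:R :> R by rewrite divr_gt0 // ltr0n.
  rewrite -[X in ln X](divfK (lt0r_neq0 K0R)) lnM ?posrE // addrC -addrA lerD2l.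
  apply: le_trans (ltW (ln_sublinear u0)) _.
  by rewrite -natr1 mulrDl [leRHS]addrC lerD2l mul1r invf_le1.
have : loc <= (ln 16 + 2 * (ln K0%:R + 1 + k%:R / K0%:R)) / ln 2.
  by rewrite ler_pM2r ?invr_gt0 // lerD2l ler_pM2l.
rewrite /base /slope;
  have -> : 2 / (K0%:R * ln 2) * k%:R = 2 * (k%:R / K0%:R) / ln 2 :> R.
  by rewrite invfM; ring.
rewrite !mulrDl !mulrDr !mulrDl; lra.
Qed.

Lemma delta_gt0 : 0 < delta.
Proof. by rewrite mulr_gt0 // expR_gt0. Qed.

Lemma base_ge0 : (0 < K0)%N -> 0 <= base.
Proof.
move=> K00; have tau0 : 0 <= tau by rewrite addr_ge0.
have ln_nat m : (0 < m)%N -> 0 <= ln m%:R :> R by move=> m0;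
  rewrite ln_ge0 // ler1n.
apply: addr_ge0; first by rewrite addr_ge0 // mulr_ge0 // mulr_ge0.
apply: divr_ge0; last exact: ltW.
by rewrite addr_ge0 // addr_ge0 ?ln_nat // mulr_ge0 // ln_nat.
Qed.

Lemma level_mean_ge0 : (0 < K0)%N -> 0 <= level_mean.
Proof.
by move=> /base_ge0 B0; rewrite addr_ge0 // divr_ge0 // mulr_ge0 // ltW.
Qed.

(** * Upper bounds for observables that are at most affine in the clocks *)

Section Upper.
Variables (f : @run R d T p -> R) (A e : R).
Hypothesis f_ge0 : forall r, 0 <= f r.
Hypothesis f_prepend : forall o r, f (prepend o r) = f r.
Hypothesis A_ge0 : 0 <= A.
Hypothesis e_ge0 : 0 <= e.
Hypothesis f_le : forall r M, 0 <= M -> (forall i, final_clocks r i <= M) ->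
  f r <= A + e * M.

(** The bound [L = level_mean / delta] on the remaining time solves
    [L = level_mean + (1 - delta) * L], which is exactly what the induction step asks for. *)
Lemma truncated_mean_le N s klo khi n clk w M : valid s klo khi n ->
  (forall i, clk i <= M) -> 0 <= M -> 0 <= w ->
  (truncated_mean N f s klo khi n clk w
   <= (w * (A + e * (M + level_mean / delta)))%:E)%E.
Proof.
have d0 := delta_gt0.
have L0 s0 klo0 khi0 n0 : valid s0 klo0 khi0 n0 -> 0 <= level_mean / delta.
  by move=> /valid_gt0 K00; rewrite divr_ge0 ?level_mean_ge0 // (ltW d0).
elim: N s klo khi n clk w M => [|N IH] s klo khi n clk w M V cM M0 w0.
  rewrite truncated_mean0 lee_fin mulr_ge0 // addr_ge0 // mulr_ge0 // addr_ge0
    //.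
  exact: L0 V.
have [nE [us ss] kk [kn kK] ck] := V.
have K00 := valid_gt0 V; have B0 := base_ge0 K00.
have K0R : 0 < K0%:R :> R by rewrite ltr0n.
have g0 : 0 <= slope by rewrite divr_ge0 // mulr_ge0 // ltW.
have {}L0 := L0 _ _ _ _ V.
pose k := rank s klo khi n; pose fail x : R := (~~ (klo <= k x <= khi))%N%:R.
have th := valid_success V.
rewrite truncated_meanS //.
(* The factor [fail x] charges the later levels only to draws that continue; constant, rank and
   failure are then averaged separately. *)
apply: le_trans (_ : (_ <= draw_mean (success klo khi n) (fun x =>
    (w * (A + e * (M + base)) + (w * e * slope * (k x)%:R
      + w * e * (level_mean / delta) * fail x))%R))%E) _.
  apply: le_esum => x _ /=; rewrite -/(k x) -/(weight klo khi n x : R).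
  have W0 := weight_valid x V.
  have cM' := level_time x V cM.
  have M0' : 0 <= M + (base + slope * (k x)%:R)
    by rewrite addr_ge0 // addr_ge0 // mulr_ge0.
  have w0' : 0 <= w * weight klo khi n x by rewrite mulr_ge0.
  have bnd : fail x = 1 -> (w * weight klo khi n x *
       (A + e * (M + (base + slope * (k x)%:R) + level_mean / delta)))%:E
     = (weight klo khi n x * (w * (A + e * (M + base))
       + (w * e * slope * (k x)%:R
      + w * e * (level_mean / delta) * fail x)))%:E.
    by move=> ->; congr _%:E; ring.
  case: ltnP => k1.
    rewrite -bnd; last by rewrite /fail leqNgt k1.
    by apply: IH => //; exact: (valid_above V k1).
  case: ltnP => k2.
    rewrite -bnd; last by rewrite /fail [(_ <= khi)%N]leqNgt k2 andbF.
    by apply: IH => //; exact: (valid_below V k2).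
  rewrite lee_fin /fail k1 k2 mulr0 addr0.
  apply: le_trans (ler_wpM2l w0' (f_le M0' _)) _ => //.
  by rewrite le_eqVlt; apply/orP; left; apply/eqP; ring.
have we0 : 0 <= w * e by rewrite mulr_ge0.
have wes0 : 0 <= w * e * slope by apply: mulr_ge0.
have weL0 : 0 <= w * e * (level_mean / delta) by apply: mulr_ge0.
have wA0 : 0 <= w * (A + e * (M + base))
  by rewrite mulr_ge0 // addr_ge0 // mulr_ge0 // addr_ge0.
have wk0 x : 0 <= w * e * slope * (k x)%:R by apply: mulr_ge0.
have wf0 x : 0 <= w * e * (level_mean / delta) * fail x by apply: mulr_ge0.
rewrite !draw_meanD // ?draw_mean_cst //; last by move=> x; rewrite addr_ge0.
rewrite !draw_meanZ //.
have kn' := kn; rewrite nE in kn'.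
have h1 := draw_mean_rank c_gt0 kk kn' ck us ss.
have h2 := draw_mean_continue c_gt0 kk kn' ck us ss.
rewrite -nE in h1 h2.
rewrite -lee_fin in wes0; rewrite -lee_fin in weL0.
have {}h1 := lee_wpmul2l wes0 h1; have {}h2 := lee_wpmul2l weL0 h2.
apply: (le_trans (leeD (lexx _) (leeD h1 h2))).
rewrite -!EFinM -!EFinD lee_fin.
have sl : slope * (2 * khi%:R / c) <= 4 / (c * ln 2).
  have -> : 4 / (c * ln 2) = slope * (2 * K0%:R / c).
    by rewrite /slope; field; rewrite !gt_eqF.
  by rewrite ler_wpM2l // ler_pM2r ?invr_gt0 // ler_pM2l // ler_nat.
have sl' := ler_wpM2l (mulr_ge0 w0 e_ge0) sl.
(* Failing with probability at most [1 - delta] lowers the future cost by [level_mean], which pays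
   for the present level. *)
have -> : w * e * (level_mean / delta) * (1 - expR (-1) * c)
   = w * e * (level_mean / delta) - w * e * level_mean.
  by rewrite -/delta; field; rewrite gt_eqF.
rewrite /level_mean in sl' *; lra.
Qed.

Lemma mean_le s klo khi : valid s klo khi (size (objects s)) ->
  (mean alpha beta s klo khi f <= (A + e * (level_mean / delta))%:E)%E.
Proof.
move=> V; apply: (@esum_exhaust _ _ size) => N.
have := @truncated_mean_le N _ _ _ _ (fun=> 0) 1 0 V (fun=> lexx 0) (lexx 0)
  ler01.
by rewrite mul1r add0r.
Qed.

End Upper.

Lemma delta_le1 s klo khi n : valid s klo khi n -> delta <= 1.
Proof.
move=> [nE _ kk [kn _] ck]; rewrite nE in kn.
have c1 : c <= 1 := gap_le1 c_gt0 kk kn ck.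
have e1 : expR (-1) <= 1 :> R by rewrite -expR0 ler_expR oppr_le0.
by apply: mulr_ile1 => //; exact: ltW.
Qed.

(** Each level stops with probability at least [delta] whatever the history, so at most
    [(1 - delta) ^ N] of the mass is left after [N] levels. *)
Lemma truncated_mean1_ge N s klo khi n clk w : valid s klo khi n -> 0 <= w ->
  ((w * (1 - (1 - delta) ^+ N))%:E
   <= truncated_mean N (fun=> 1%R) s klo khi n clk w)%E.
Proof.
have d0 := delta_gt0.
elim: N s klo khi n clk w => [|N IH] s klo khi n clk w V w0.
  by rewrite truncated_mean0 expr0 subrr mulr0.
have [nE [us ss] kk [kn kK] ck] := V.
have d1 := delta_le1 V.
pose k := rank s klo khi n; pose fail x : R := (~~ (klo <= k x <= khi))%N%:R.
have th := valid_success V.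
have r0 : 0 <= 1 - delta by rewrite subr_ge0.
have r1 : (1 - delta) ^+ N <= 1 by rewrite exprn_ile1 // lerBlDr lerDl ltW.
rewrite truncated_meanS //.
apply: le_trans (_ : (_ <= draw_mean (success klo khi n) (fun x =>
    (w * (1 - (1 - delta) ^+ N * fail x))%R))%E) _; last first.
  apply: le_esum => x _ /=; rewrite -/(k x) -/(weight klo khi n x : R).
  have W0 := weight_valid x V.
  have w0' : 0 <= w * weight klo khi n x by rewrite mulr_ge0.
  case: ltnP => k1.
    rewrite /fail leqNgt k1 mulr1 mulrA [_ * w]mulrC.
    by apply: IH => //; exact: (valid_above V k1).
  case: ltnP => k2.
    rewrite /fail [(_ <= khi)%N]leqNgt k2 andbF mulr1 mulrA [_ * w]mulrC.
    by apply: IH => //; exact: (valid_below V k2).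
  by rewrite /fail k1 k2 mulr0 subr0 mulrA [_ * w]mulrC.
have kn' := kn; rewrite nE in kn'.
have h2 := draw_mean_continue c_gt0 kk kn' ck us ss; rewrite -nE in h2.
(* This identity turns the upper bound on the mean of [fail] into a lower bound on the wanted
   mean. *)
have : (draw_mean (success klo khi n) (fun x => (w * (1 - (1 - delta) ^+ N *
  fail x))%R)
   + (w * (1 - delta) ^+ N)%:E * draw_mean (success klo khi n) fail = w%:E)%E.
  rewrite -draw_meanZ // ?mulr_ge0 ?exprn_ge0 // -draw_meanD //; last 2 first.
  - move=> x; rewrite mulr_ge0 // subr_ge0 mulr_ile1 ?exprn_ge0 //.
    by rewrite /fail; case: (~~ _).
  - by move=> x; rewrite !mulr_ge0 // exprn_ge0.
  by rewrite -[RHS](draw_mean_cst p th w0); apply: eq_draw_mean => x; ring.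
have := lee_wpmul2l (_ : 0 <= (w * (1 - delta) ^+ N)%:E)%E h2.
rewrite lee_fin mulr_ge0 ?exprn_ge0 // => /(_ isT).
rewrite -/(k _) -/(fail _).
set E1 := (_ * draw_mean _ _)%E; set E2 := draw_mean _ _.
rewrite -EFinM; case: E1 => [E1| |]; case: E2 => [E2| |] //.
rewrite -EFinD !lee_fin => h [h'].
by rewrite exprSr mulrBr mulrA mulr1 /delta in h *; lra.
Qed.

Lemma mean1_ge s klo khi : valid s klo khi (size (objects s)) ->
  (1 <= mean alpha beta s klo khi (fun=> 1%R))%E.
Proof.
move=> V; apply/lee_subgt0Pr => e e0.
have q1 : `|1 - delta| < 1.
  by rewrite ger0_norm ?subr_ge0 ?(delta_le1 V) // ltrBlDr ltrDl delta_gt0.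
have [N _ /(_ N (leqnn N)) /= he] := cvgr_le _ (cvg_expr q1) _ e0.
apply: le_trans (@subset_esum _ _ [set h : seq (@draws p) | (size h <= N)%N]
  _ _ (@subsetT _ _)).
apply: le_trans (truncated_mean1_ge N (fun=> 0) V ler01).
by rewrite mul1r -EFinB lee_fin lerD2l lerN2.
Qed.

End Recursion.

(** * From explicit constants to the asymptotic bound *)

Lemma up_log_le (R : realType) p : (0 < p)%N ->
  (up_log 2 p)%:R * ln 2 <= 2 * ln p%:R :> R.
Proof.
(* Both sides vanish for [p = 1]. Otherwise rounding up costs at most one more [ln 2], which is at
   most [ln p]. *)
case: p => [|[|p]] // _; first by rewrite up_log1 mul0r ln1 mulr0.
set u := up_log 2 p.+2; have ln2 : 0 < ln 2 :> R by rewrite ln_gt0 // ltr1n.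
have /andP[up _] : (2 ^ u.-1 < p.+2 <= 2 ^ u)%N by exact: up_log_bounds.
have u0 : (0 < u)%N by have := up_logP p.+2 (isT : 1 < 2)%N; rewrite -/u;
  case: (u).
have h : u.-1%:R * ln 2 <= ln p.+2%:R :> R.
  rewrite mulr_natl -lnXn // -natrX ler_ln ?posrE ?ltr0n ?expn_gt0 //.
  by rewrite ler_nat ltnW.
have h2 : ln 2 <= ln p.+2%:R :> R by rewrite ler_ln ?posrE ?ltr0n // ler_nat.
have -> : u%:R = u.-1%:R + 1 :> R by rewrite natr1 prednK.
lra.
Qed.

(** The constant [c] makes the Omega condition explicit, and [C] depends on [c], [a0] and [b] alone.
    Through [a0] and [b] the unit of local work and the word cost of each message are charged to
    [alpha]. Termination with probability 1 makes [mean] a genuine expectation. *)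
Theorem theorem3 (R : realType) (c a0 b : R) (c_gt0 : 0 < c)
    (a0_gt0 : 0 < a0) (b_gt0 : 0 < b) :
  exists C : R, 0 < C /\
    forall (d : Order.disp_t) (T : orderType d) (p : nat) (s : 'I_p -> seq T)
           (klo khi : nat) (alpha beta : R),
      uniq (objects s) ->
      (forall i, sorted <%O (s i)) ->
      (0 < klo <= khi)%N ->
      (klo <= size (objects s))%N ->
      c * khi%:R <= (khi - klo)%:R ->
      a0 <= alpha ->
      0 <= beta <= b * alpha ->
      [/\ forall (h : seq draws) (r : run),
            ams_run alpha beta s klo khi h = Some r ->
            exists2 k, (klo <= k <= khi)%N & selects_smallest s k (output r),
          mean alpha beta s klo khi (fun=> 1) = 1%E
        & (mean alpha beta s klo khi running_time
             <= (C * (ln khi%:R + alpha * ln p%:R))%:E)%E].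
Proof.
pose delta := expR (-1) * c.
have d0 : 0 < delta by rewrite mulr_gt0 // expR_gt0.
have ln2 : 0 < ln 2 :> R by rewrite ln_gt0 // ltr1n.
(* [X] collects the summands of [level_mean] that depend on neither [khi] nor [p]. *)
pose X := 2 + (ln 16 + 2 + 4 / c) / ln 2.
(* The three summands account for [alpha], [beta] and the unit of combining time in one
   communication step, measured in multiples of [alpha]. *)
pose D := 1 + b + a0^-1.
have c4 : 0 < 4 / c by rewrite divr_gt0.
have ln16 : 0 <= ln 16 :> R by rewrite ln_ge0 // ler1n.
have X0 : 0 < X by rewrite addr_gt0 // divr_gt0 //; lra.
have D0 : 0 < D by rewrite !addr_gt0 // invr_gt0.
have V0 : 0 < (X + 2 + 8 * D) / ln 2 by rewrite divr_gt0 //; lra.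
exists ((X + 2 + 8 * D) / ln 2 / delta); split; first by rewrite divr_gt0.
move=> d T p s klo khi alpha beta us ss' kk kn ck aa /andP[beta0 bb].
have ss i : sorted <=%O (s i) by move: (ss' i);
  rewrite lt_sorted_uniq_le => /andP[].
have alpha0 : 0 < alpha by exact: lt_le_trans aa.
have time_ge0 : 0 <= message_time alpha beta 1.
  by rewrite addr_ge0 ?(ltW alpha0) // mulr_ge0.
(* [K0] is taken to be the initial [khi]. *)
have V : valid c khi s klo khi (size (objects s)) by split.
have p0 : (0 < p)%N.
  case: (posnP p) => // p0; subst p.
  have s0 : size (objects s) = 0%N
    by rewrite -count_predT count_objects big_ord0.
  by move: kk; rewrite s0 leqn0 in kn; rewrite (eqP kn).
split.
- move=> h r /(amsSelect_selects ss)[|P [dP oE kP]]; first by case/andP: kk.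
  by exists (count P (objects s)) => //; rewrite oE;
    exact: selects_smallest_down.
- apply/eqP; rewrite eq_le (mean1_ge c_gt0 time_ge0 V) andbT.
  have := mean_le (f := fun=> 1) (A := 1) (e := 0) c_gt0 time_ge0 _ _ _ _ _ V.
  rewrite mul0r addr0; apply=> // r M _ _; by rewrite mul0r addr0.
have := mean_le (f := running_time) (A := 0) (e :=
  1) c_gt0 time_ge0 _ _ _ _ _ V.
rewrite mul1r add0r => h; apply: (le_trans (h _ _ _ _ _)) => //.
- by move=> r; exact: bigmax_ge_id.
- move=> r M M0 cM; rewrite mul1r add0r /running_time.
  by elim/big_ind: _ => // x y xM yM; rewrite ge_max xM.
rewrite lee_fin [leRHS]mulrAC ler_pM2r ?invr_gt0 //.
(* The gap is positive, so [khi >= 2], and additive constants can be absorbed into [ln khi]. *)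
have khi2 : (1 < khi)%N.
  have [klo0 klohi] := andP kk.
  have : 0 < (khi - klo)%:R :> R.
    by apply: lt_le_trans ck; rewrite mulr_gt0 // ltr0n (leq_trans klo0).
  by rewrite ltr0n subn_gt0; exact: leq_ltn_trans.
have lk : ln 2 <= ln khi%:R :> R
  by rewrite ler_ln ?posrE ?ltr0n ?ler_nat // ltnW.
have lp0 : 0 <= ln p%:R :> R by rewrite ln_ge0 // ler1n.
have up : (up_log 2 p)%:R * ln 2 <= 2 * ln p%:R :> R by exact: up_log_le.
have tD : message_time alpha beta 1 + 1 <= alpha * D.
  rewrite /message_time mul1r /D !mulrDr mulr1 lerD // ?lerD2l 1?mulrC //.
  by rewrite mulrC ler_pdivlMr // mul1r.
rewrite [leRHS]mulrAC ler_pdivlMr // /level_mean natrM.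
move: lk up tD X0 D0 ln2; rewrite invfM.
set L2 := ln 2; set LK := ln _; set LP := ln _; set u := (up_log _ _)%:R.
set tau := _ + 1.
move=> lk up tD X0 D0 ln2.
have -> : (2 + 2 * (2 * u * tau) + (ln 16 + 2 * LK + 2) / L2
  + 4 * (c^-1 / L2)) * L2
  = X * L2 + 4 * (u * L2 * tau) + 2 * LK.
  by rewrite /X -/L2; field; rewrite ?gt_eqF.
have h1 : X * L2 <= X * LK by rewrite ler_pM2l.
have h2 : u * L2 * tau <= 2 * LP * (alpha * D).
  by apply: ler_pM => //; [rewrite mulr_ge0 // ltW|rewrite addr_ge0].
(* These are the surplus cross terms of the product [(X + 2 + 8 * D) * (LK + alpha * LP)]. *)
have h3 : 0 <= (X + 2) * (alpha * LP) + 8 * D * LK.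
  have LK0 : 0 <= LK by exact: le_trans (ltW ln2) lk.
  by rewrite addr_ge0 // mulr_ge0 //;
    [rewrite addr_ge0 // ltW|rewrite mulr_ge0 // ltW|rewrite mulr_ge0 // ltW].
have -> : (X + 2 + 8 * D) * (LK + alpha * LP) =
  X * LK + 2 * LK + 4 * (2 * LP * (alpha * D)) + ((X + 2) * (alpha * LP)
    + 8 * D * LK) by ring.
lra.
Qed.
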